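(* Let $V$ be a real vector space endowed with its finest locally convex topology $\mathfrak{T}_\omega(V)$ and let $K\subset V$ be a convex subset. Then the relative interior $\operatorname{ri}(K)$ of $K$ for the topology $\mathfrak{T}_\omega(V)$ equals the relative algebraic interior of $K$: $\operatorname{ri}(K)=\operatorname{rai}(K)$.
   Context: A topological real vector space is locally convex if $0$ has a fundamental system of neighborhoods that are convex sets. $\mathfrak{T}_\omega(V)$ denotes the finest locally convex (vector space) topology on $V$. The relative interior $\operatorname{ri}(K)$ is the interior of $K$ in the topology induced by $\mathfrak{T}_\omega(V)$ on the affine hull $\operatorname{aff}(K)$ of $K$. For $x\neq y$ the open segment is $(x,y)=\{(1-\lambda)x+\lambda y:\lambda\in(0,1)\}$. The relative algebraic interior $\operatorname{rai}(K)$ is the set of all points $x\in K$ such that for every line $g$ in $\operatorname{aff}(K)$ containing $x$, the intersection $g\cap K$ includes an open segment (with distinct endpoints) containing $x$. *)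

(* Defs.v *)
From HB Require Import structures.
From mathcomp Require Import all_boot all_order all_algebra.
From mathcomp Require Import all_classical all_reals all_analysis.

Set Implicit Arguments.
Unset Strict Implicit.
Unset Printing Implicit Defensive.

Import Order.TTheory GRing.Theory Num.Theory.
Import numFieldNormedType.Exports.

Local Open Scope classical_set_scope.
Local Open Scope ring_scope.

(* A topology on (the carrier of) V is an element m of the library's class     *)
(* [Topological V]; [top m] is V seen as a topological space through m. This   *)
(* lets one compare several topologies on the same V.                          *)
Notation top m := (Topological.Pack m).

Section Definitions.
Variables (R : realType) (V : lmodType R).

(* Hausdorffness is not required. *)
Definition vector_space_topology (m : Topological V) : Prop :=
  continuous (fun z : top m * top m => ((z.1 : V) + z.2) : top m) /\
  continuous (fun z : R^o * top m => (z.1 *: (z.2 : V)) : top m).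

Definition locally_convex_topology (m : Topological V) : Prop :=
  vector_space_topology m /\
  forall U : set V, nbhs ((0 : V) : top m) (U : set (top m)) ->
    exists C : set V,
      [/\ nbhs ((0 : V) : top m) (C : set (top m)), convex_set C & C `<=` U].

Definition coarser (m m' : Topological V) : Prop :=
  (open : set_system (top m)) `<=` (open : set_system (top m')).

Definition finest_locally_convex (m : Topological V) : Prop :=
  locally_convex_topology m /\
  forall m' : Topological V, locally_convex_topology m' -> coarser m' m.

Definition affine_set (A : set V) : Prop :=
  forall x y (t : R), A x -> A y -> A ((1 - t) *: x + t *: y).

Definition aff (K : set V) : set V := smallest affine_set K.

(* [subspace A] carries the induced topology on A; it keeps V as carrier and   *)
(* makes the points outside A isolated, which is harmless since K is included  *)
(* in aff K.                                                                   *)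
Definition ri (m : Topological V) (K : set V) : set V :=
  ((K : set (subspace (aff K : set (top m))))°)%classic.

Definition line (g : set V) : Prop :=
  exists p v : V, v != 0 /\ g = [set p + t *: v | t in [set: R]].

Definition open_segment (x y : V) : set V :=
  [set (1 - t) *: x + t *: y | t in [set t : R | 0 < t < 1]].

Definition rai (K : set V) : set V :=
  [set x | K x /\
    forall g : set V, line g -> g `<=` aff K -> g x ->
      exists a b : V,
        [/\ a != b, open_segment a b `<=` g `&` K & open_segment a b x]].

End Definitions.

Section Existence.
Variables (R : realType) (V : lmodType R).

Let I := {m : Topological V | locally_convex_topology m}.
Let S := sup_topology (fun i : I => projT1 i).
Let sup : Topological V := Topological.class S.

Let sup_finer (x : V) (i : I) :
  nbhs (x : top sup) --> (x : top (projT1 i)).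
Proof.
apply: (proj1 (@cvg_sup V I (fun i => projT1 i) (nbhs (x : S)) x _)).
exact: cvg_id.
Qed.

Let cvgS (F : set_system V) (x : V) : Filter F ->
  (forall i : I, F --> (x : top (projT1 i))) -> F --> (x : top sup).
Proof. by move=> FF H; apply/(@cvg_sup V I (fun i => projT1 i) F x). Qed.

Let sup_lc : locally_convex_topology sup.
Proof.
split; first split.
- move=> z; apply: cvgS => i.
  have [[+ _] _] := projT2 i => /(_ z); apply: cvg_trans.
  apply: cvg_app; move=> A [[P Q] [nP nQ] PQ]; exists (P, Q) => //.
  by split; [exact: (@sup_finer z.1 i P nP)|exact: (@sup_finer z.2 i Q nQ)].
- move=> z; apply: cvgS => i.
  have [[_ +] _] := projT2 i => /(_ z); apply: cvg_trans.
  apply: cvg_app; move=> A [[P Q] [nP nQ] PQ]; exists (P, Q) => //.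
  by split; [exact: nP|exact: (@sup_finer z.2 i Q nQ)].
- pose D := [set C : set V | nbhs ((0 : V) : top sup) (C : set (top sup)) /\
                             convex_set C].
  have FF : Filter (filter_from D id).
    apply: filter_from_filter.
      exists setT; split; first exact: filterT.
      by move=> x y l _ _; rewrite inE.
    move=> A B [nA cA] [nB cB]; exists (A `&` B) => //; split.
      exact: filterI.
    move=> x y l; rewrite !inE => -[Ax Bx] [Ay By]; split; apply/set_mem.
      by apply: cA; rewrite inE.
    by apply: cB; rewrite inE.
  have : filter_from D id --> ((0 : V) : top sup).
    apply: cvgS => i U /=.
    have [_ +] := projT2 i => /[apply] -[C [nC cC CU]].
    by exists C => //; split => //; apply: sup_finer nC.
  by move=> cv U nU; have [C [nC cC] CU] := cv U nU; exists C.
Qed.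

Lemma finest_locally_convex_exists :
  exists m : Topological V, finest_locally_convex m.
Proof.
exists sup; split; first exact: sup_lc.
move=> m' lcm' U; rewrite !openE => oU x Ux.
exact: (@sup_finer x (exist _ m' lcm')) (oU x Ux).
Qed.

End Existence.

(* Main.v *)
(* ri K is contained in rai K because t |-> x + t v is continuous. Conversely,
   let x be in rai K and let L = aff K - x, a linear subspace in which the
   symmetric convex set C of all u in L with x + u and x - u in K is absorbing.
   Choose a complement M of L by Zorn's lemma. Then D = C + M is absolutely
   convex and absorbing in V, so its gauge defines a locally convex topology,
   which is coarser than the finest one. Hence x + D is a neighborhood of x,
   and its points in aff K lie in K because L and M meet only in 0. *)
Require Import Defs.
From HB Require Import structures.
From mathcomp Require Import all_boot all_order all_algebra.
From mathcomp Require Import all_classical all_reals all_analysis.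
From mathcomp Require Import lra.

Set Implicit Arguments.
Unset Strict Implicit.
Unset Printing Implicit Defensive.

Import Order.TTheory GRing.Theory Num.Theory.
Import numFieldNormedType.Exports.

Local Open Scope classical_set_scope.
Local Open Scope ring_scope.

(** * Complements of linear subspaces *)

Section LinearSubspaces.
Variables (K : fieldType) (V : lmodType K).
Implicit Types (L M : set V) (u v w : V).

Definition linear_subspace L :=
  [/\ L 0, forall u v, L u -> L v -> L (u + v)
    & forall a v, L v -> L (a *: v)].

(** Take [M] maximal among the subspaces meeting [L] only in 0. If some [w] were outside [L + M],
    adjoining the line through [w] would enlarge [M] and still meet [L] trivially. *)
Lemma linear_subspace_complement L : linear_subspace L ->
  exists M, [/\ linear_subspace M, L `&` M `<=` [set 0]
    & forall w, exists u v, [/\ L u, M v & w = u + v]].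
Proof.
move=> [L0 LD LZ].
(* The empty set is admitted so that the union of the empty chain qualifies. *)
pose P (M : set V) := [/\ forall u v, M u -> M v -> M (u + v),
  forall a v, M v -> M (a *: v) & L `&` M `<=` [set 0]].
have [F FP Ftot|M [[MD MZ LM] Mmax]] := @Zorn_bigcup V P.
  split.
  - move=> u v [X FX Xu] [Y FY Yv].
    have [XY|YX] := Ftot _ _ FX FY.
      by exists Y => //; have [YD _ _] := FP _ FY; exact: YD (XY _ Xu) Yv.
    by exists X => //; have [XD _ _] := FP _ FX; exact: XD Xu (YX _ Yv).
  - move=> a v [X FX Xv]; exists X => //.
    by have [_ XZ _] := FP _ FX; exact: XZ.
  - move=> v [Lv [X FX Xv]].
    by have [_ _ XL] := FP _ FX; exact: XL.
(* Since [P] admits the empty set, this comes from maximality: adjoining 0 to [M] preserves [P]. *)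
have M0 : M 0.
  apply: contrapT => nM0; apply: (Mmax (M `|` [set 0])); first split.
  - by move=> v Mv; left.
  - by move=> /(_ 0 (or_intror erefl)).
  - split.
    + move=> u v [Mu|->] [Mv|->]; rewrite ?addr0 ?add0r.
      * by left; exact: MD.
      * by left.
      * by left.
      * by right.
    + by move=> a v [Mv|->]; [left; exact: MZ|right; exact: scaler0].
    + by move=> v [Lv [Mv|//]]; apply: LM.
exists M; split => // w; apply: contrapT => nw.
pose N := [set v | exists n a, M n /\ v = n + a *: w].
apply: (Mmax N); first split.
- by move=> v Mv; exists v, 0; rewrite scale0r addr0.
- move=> NM; apply: nw; exists 0, w; rewrite add0r; split => //.
  by apply: NM; exists 0, 1; rewrite add0r scale1r.
- split.
  + move=> _ _ [n [a [Mn ->]]] [n' [a' [Mn' ->]]]; exists (n + n'), (a + a').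
    by split; [exact: MD|rewrite scalerDl addrACA].
  + move=> b _ [n [a [Mn ->]]]; exists (b *: n), (b * a).
    by split; [exact: MZ|rewrite scalerDr scalerA].
  + move=> v [Lv [n [a [Mn vE]]]].
    have [a0|a0] := eqVneq a 0.
      by apply: LM; split => //; rewrite vE a0 scale0r addr0.
    (* Solving [v = n + a *: w] for [w] puts [w] in [L + M]. *)
    exfalso; apply: nw; exists (a^-1 *: v), (- a^-1 *: n).
    split; [exact: LZ|exact: MZ|].
    by rewrite vE scalerDr scalerA mulVf// scale1r scaleNr addrAC subrr add0r.
Qed.

End LinearSubspaces.

(** * Absolutely convex absorbing sets *)

Section ConvexSets.
Variables (R : realType) (V : lmodType R).
Implicit Types (C D : set V) (u v x : V).

(** Trades coefficients bundled with their interval for plain reals. The library puts the weight on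
    the first point, hence the swap of [u] and [v]. *)
Lemma convex_setP C : convex_set C <->
  forall u v (t : R), 0 <= t <= 1 -> C u -> C v -> C ((1 - t) *: u + t *: v).
Proof.
split=> [cC u v t /andP[t0 t1] Cu Cv|cC u v l].
  have t01 : Itv.spec (@Itv.num_sem R) (Itv.Real `[0%Z, 1%Z]) t.
    by apply/and3P; split; rewrite ?ger0_real ?bnd_simp.
  rewrite addrC; apply/set_mem.
  by apply: (cC v u (Itv.mk t01)); rewrite inE.
rewrite !inE => Cu Cv; rewrite /conv/= addrC.
by apply: (cC v u) => //; rewrite ge0 le1.
Qed.

Definition absolutely_convex_absorbing D :=
  [/\ convex_set D, forall d, D d -> D (- d)
    & forall v, exists2 t : R, 0 < t & D (t *: v)].

Section Theory.
Variables (D : set V) (HD : absolutely_convex_absorbing D).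

Lemma absorbing0 : D 0.
Proof.
have [_ _ /(_ 0)[t _]] := HD.
by rewrite scaler0.
Qed.

Lemma absconvexZ (s : R) d : `|s| <= 1 -> D d -> D (s *: d).
Proof.
have [/convex_setP cD DN _] := HD => s1 Dd.
wlog s0 : s d s1 Dd / 0 <= s.
  move=> wl; have [|/ltW s0] := leP 0 s; first exact: wl.
  rewrite -(opprK s) scaleNr -scalerN.
  by apply: wl; rewrite ?normrN ?oppr_ge0//; exact: DN.
have := cD 0 d s; rewrite scaler0 add0r; apply => //; last exact: absorbing0.
by rewrite s0 (le_trans (ler_norm _) s1).
Qed.

(** The triangle inequality for the gauge of [D]. With [s] the sum of the absolute values,
    [a *: u + b *: v] is [s] times a convex combination of [u] and [v] taken with the signs of [a]
    and [b], and [s / e <= 1] allows shrinking within [D]. *)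
Lemma absconvex_comb (e a b : R) u v : 0 < e -> `|a| + `|b| <= e ->
  D u -> D v -> exists2 d, D d & a *: u + b *: v = e *: d.
Proof.
have [/convex_setP cD _ _] := HD => e0 abe Du Dv.
have sgD (c : R) w : D w -> D (Num.sg c *: w).
  by move=> Dw; apply: absconvexZ => //; rewrite normr_sg; case: (c != 0).
have [ab0|ab0] := eqVneq (`|a| + `|b|) 0.
  have [a0 b0] : a = 0 /\ b = 0.
    by split; apply: normr0_eq0; have := normr_ge0 a; have := normr_ge0 b; lra.
  by exists 0; [exact: absorbing0|rewrite a0 b0 !scale0r addr0 scaler0].
have abp : 0 < `|a| + `|b| by rewrite lt_neqAle eq_sym ab0 addr_ge0.
set s := `|a| + `|b| in abe ab0 abp *.
exists ((s / e) *: ((1 - `|b| / s) *: (Num.sg a *: u)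
                    + (`|b| / s) *: (Num.sg b *: v))).
  apply: absconvexZ.
    by rewrite gtr0_norm ?divr_gt0// ler_pdivrMr// mul1r.
  apply: cD; [|exact: sgD|exact: sgD].
  by rewrite divr_ge0 ?(ltW abp)//= ler_pdivrMr// mul1r /s lerDr.
rewrite scalerA mulrC divfK ?gt_eqF// scalerDr !scalerA.
rewrite mulrBr mulr1 [s * _]mulrC divfK//.
rewrite /s addrK !(mulrC `|_|) -!numEsg//.
Qed.

End Theory.

(* The topology whose neighborhoods of x are the supersets of the x + e D,
   e > 0; equivalently, the one given by the gauge of D. *)
Definition gauge_space D (HD : absolutely_convex_absorbing D) : Type := V.

(** * The locally convex topology given by a gauge *)

Section GaugeTopology.
Variables (D : set V) (HD : absolutely_convex_absorbing D).
Local Notation T := (gauge_space HD).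

HB.instance Definition _ := Choice.copy T V.

Definition gauge_nbhs (x : T) : set_system T :=
  [set U | exists2 e : R, 0 < e & forall d : V, D d -> U ((x : V) + e *: d)].

HB.instance Definition _ := hasNbhs.Build T gauge_nbhs.

Let gauge_nbhs_filter (x : T) : ProperFilter (nbhs x).
Proof.
apply: Build_ProperFilter_ex.
  move=> A [e e0 eA]; exists ((x : V) + e *: 0).
  exact: eA (absorbing0 HD).
split.
- by exists 1.
- move=> A B [e e0 eA] [f f0 fB]; exists (Num.min e f).
    by rewrite lt_min e0.
  have sub (g : R) d : 0 < g -> Num.min e f <= g -> D d ->
      exists2 d', D d' & Num.min e f *: d = g *: d'.
    move=> g0 efg Dd; exists ((Num.min e f / g) *: d).
      apply: (absconvexZ HD) Dd.
      by rewrite gtr0_norm ?ler_pdivrMr ?mul1r// divr_gt0// lt_min e0.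
    by rewrite scalerA mulrC divfK ?gt_eqF.
  move=> d Dd; split.
    have [|d' Dd' ->] := sub e d e0 _ Dd; first by rewrite ge_min lexx.
    exact: eA.
  have [|d' Dd' ->] := sub f d f0 _ Dd; first by rewrite ge_min lexx orbT.
  exact: fB.
- by move=> A B AB [e e0 eA]; exists e => // d Dd; apply/AB/eA.
Qed.

Let gauge_nbhs_singleton (x : T) (A : set T) : nbhs x A -> A x.
Proof.
move=> [e e0 eA]; have := eA _ (absorbing0 HD).
by rewrite scaler0 addr0.
Qed.

Let gauge_nbhs_nbhs (x : T) (A : set T) : nbhs x A -> nbhs x (nbhs^~ A).
Proof.
move=> [e e0 eA]; exists (e / 2); first by rewrite divr_gt0.
(* Two successive steps in [(e / 2) D] add up to one in [e D]. *)
move=> d Dd; exists (e / 2); first by rewrite divr_gt0.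
move=> d' Dd'; rewrite -addrA.
have [|d'' Dd'' ->] := absconvex_comb HD (a := e / 2) (b := e / 2) e0 _ Dd Dd'.
- by rewrite gtr0_norm ?divr_gt0//; lra.
- exact: eA.
Qed.

HB.instance Definition _ := Nbhs_isNbhsTopological.Build T
  gauge_nbhs_filter gauge_nbhs_singleton gauge_nbhs_nbhs.

End GaugeTopology.

Lemma gauge_locally_convex D (HD : absolutely_convex_absorbing D) :
  @locally_convex_topology R V (Topological.class (gauge_space HD)).
Proof.
have [/convex_setP cD _ absD] := HD.
split; first split.
- move=> [x y] /= A [e e0 eA].
  have e20 : 0 < e / 2 by rewrite divr_gt0.
  exists ([set u : V | exists2 d, D d & u = x + (e / 2) *: d],
          [set u : V | exists2 d, D d & u = y + (e / 2) *: d]).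
    by split; exists (e / 2) => // d Dd; exists d.
  move=> [_ _] /= [[d Dd ->] [d' Dd' ->]]; rewrite addrACA.
  have [|f Df ->] := absconvex_comb HD (a := e / 2) (b := e / 2) e0 _ Dd Dd'.
  + by rewrite gtr0_norm//; lra.
  + exact: eA.
- move=> [t x] /= A [e e0 eA].
  (* Write [s *: (x + q *: d) - t *: x] as [((s - t) / k) *: (k *: x) + (s * q) *: d], with [k *: x]
     in [D]. The bound [e * k / 2] in [r] controls the first coefficient by [e / 2]; the bound 1
     gives [|s| <= |t| + 1], so that [q] does the same for the second. *)
  have [k k0 Dk] := absD x.
  pose r := Num.min 1 (e * k / 2).
  have r0 : 0 < r by rewrite lt_min ltr01 divr_gt0// mulr_gt0.
  pose q := e / 2 / (`|t| + 1).
  have t10 : 0 < `|t| + 1 by rewrite ltr_wpDl.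
  have q0 : 0 < q by rewrite divr_gt0// divr_gt0.
  exists (ball (t : R^o) r, [set u : V | exists2 d, D d & u = x + q *: d]).
    by split; [exact: nbhsx_ballx|exists q => // d Dd; exists d].
  move=> [s _] /= [ts [d Dd ->]].
  have {ts} ts : `|s - t| < r by rewrite distrC; exact: ts.
  have [|f Df fE] :=
      absconvex_comb HD (a := (s - t) / k) (b := s * q) e0 _ Dk Dd; last first.
    suff -> : s *: (x + q *: d) = t *: x + e *: f by exact: eA.
    rewrite -fE !scalerA divfK ?gt_eqF// addrA -scalerDl scalerDr scalerA.
    by rewrite [t + _]addrC subrK.
  have stk : `|(s - t) / k| <= e / 2.
    rewrite normrM normfV (gtr0_norm k0) ler_pdivrMr//.
    rewrite (le_trans (ltW ts))// /r ge_min; apply/orP; right; lra.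
  have sq : `|s * q| <= e / 2.
    rewrite normrM (gtr0_norm q0) mulrCA ler_piMr ?divr_ge0 ?(ltW e0)//.
    rewrite ler_pdivrMr// mul1r -(subrK t s) (le_trans (ler_normD _ _))//.
    by rewrite addrC lerD2l (le_trans (ltW ts))// /r ge_min lexx.
  by rewrite [leRHS](splitr e) lerD.
- move=> U [e e0 eU]; exists [set u : V | exists2 d, D d & u = e *: d]; split.
  + by exists e => // d Dd; exists d => //; rewrite add0r.
  + apply/convex_setP => _ _ a a01 [d Dd ->] [d' Dd' ->].
    exists ((1 - a) *: d + a *: d'); first exact: cD.
    by rewrite scalerDr !scalerA ![e * _]mulrC.
  + by move=> _ [d Dd ->]; have := eU d Dd; rewrite add0r.
Qed.

End ConvexSets.

(** * Comparison of the two relative interiors *)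

Section RelativeInterior.
Variables (R : realType) (V : lmodType R).
Implicit Types (m : Topological V) (K : set V) (u v x : V).

Lemma coarser_nbhs m m' x (U : set V) : coarser m' m ->
  nbhs (x : top m') (U : set (top m')) -> nbhs (x : top m) (U : set (top m)).
Proof.
move=> mm'; rewrite !nbhsE => -[B [oB Bx] BU]; exists B => //; split => //.
exact: mm'.
Qed.

(** Here the maximality of [m] enters: [x + D] is the gauge neighborhood of radius 1, and the gauge
    topology is coarser than [m]. *)
Lemma finest_nbhs m D x : finest_locally_convex m ->
  absolutely_convex_absorbing D ->
  nbhs (x : top m) ([set x + d | d in D] : set (top m)).
Proof.
move=> [_ mfin] HD; apply: coarser_nbhs (mfin _ (gauge_locally_convex HD)) _.
by exists 1 => // d Dd; exists d => //; rewrite scale1r.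
Qed.

Lemma vector_space_topology_line m x v (U : set V) :
  vector_space_topology m -> nbhs (x : top m) (U : set (top m)) ->
  \forall t \near (0 : R^o), U (x + t *: v).
Proof.
move=> [cD cZ] xU.
have : nbhs ((x : V) + 0 : top m) (U : set (top m)) by rewrite addr0.
move=> /(cD (x, 0) U)[[P Q] [/= Px Q0] PQ].
have : nbhs ((0 : R) *: v : top m) (Q : set (top m)) by rewrite scale0r.
move=> /(cZ (0, v) Q)[[S T] [/= S0 Tv] ST].
apply: filterS S0 => t St; apply: (PQ (x, t *: v)); split => /=.
  exact: (@nbhs_singleton (top m) _ _ Px).
by apply: (ST (t, v)); split => //; exact: (@nbhs_singleton (top m) _ _ Tv).
Qed.

Lemma subset_aff K : K `<=` aff K.
Proof. by move=> x Kx A [_]; apply. Qed.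

Lemma affine_aff K : affine_set (aff K).
Proof.
move=> x y t Kx Ky A [aA KA].
by apply: (aA); [exact: Kx A (conj aA KA)|exact: Ky A (conj aA KA)].
Qed.

Lemma affine_direction (A : set V) x : affine_set A -> A x ->
  linear_subspace [set v | A (x + v)].
Proof.
move=> aA Ax.
have AZ (a : R) v : A (x + v) -> A (x + a *: v).
  move=> Av; have := aA x (x + v) a Ax Av.
  by rewrite scalerDr addrA -scalerDl subrK scale1r.
split => /=; [by rewrite addr0| |exact: AZ].
(* The midpoint of [x + u] and [x + v] is [x + (u + v) / 2]; stretching by 2 from [x] gives the
   sum. *)
move=> u v Au Av; have := aA _ _ (2^-1) Au Av.
rewrite !scalerDr addrACA -scalerDl subrK scale1r => /(AZ 2 _).
rewrite scalerDr !scalerA mulrBr mulr1 mulfV ?pnatr_eq0//.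
by rewrite -(natrB _ (ltnW (ltnSn 1))) !scale1r.
Qed.

Lemma riP m K x :
  ri m K x <->
  aff K x /\ nbhs (x : top m) ([set y | aff K y -> K y] : set (top m)).
Proof.
rewrite /ri /interior/=; case: (@nbhs_subspaceP (top m) (aff K) x) => Ax.
  by split=> [? //|[]].
(* Outside [aff K] the point [x] is isolated, so being interior only says [K x], which contradicts
   [K] lying in [aff K]. *)
split=> [|[]//]; move=> /(_ x erefl) Kx.
by case: Ax; exact: subset_aff.
Qed.

Lemma ri_sub_rai m K : vector_space_topology m -> ri m K `<=` rai K.
Proof.
move=> mV x /riP[Ax nx]; split; first exact: (nbhs_singleton nx) Ax.
move=> _ [p [v [v0 ->]]] gA [t0 _ xE].
have /nbhs_ballP[e /= e0 eK] := vector_space_topology_line v mV nx.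
have e20 : 0 < e / 2 by rewrite divr_gt0.
(* The segment is centered at [x], reached at [s = 1/2]; the offset [(2 * s - 1) * (e / 2)] stays in
   the ball of radius [e]. *)
have segE (s : R) : (1 - s) *: (x - (e / 2) *: v) + s *: (x + (e / 2) *: v) =
    x + ((2 * s - 1) * (e / 2)) *: v.
  rewrite !scalerDr addrACA -scalerDl subrK scale1r scalerN -scaleNr !scalerA.
  by rewrite -scalerDl; congr (_ + _ *: _); lra.
exists (x - (e / 2) *: v), (x + (e / 2) *: v); split.
- apply/eqP => /addrI/eqP; rewrite -subr_eq0 -opprD oppr_eq0 -scalerDl.
  by rewrite scaler_eq0 (negbTE v0) orbF -splitr gt_eqF.
- move=> _ [s /andP[s0 s1] <-]; rewrite segE.
  set r := (2 * s - 1) * (e / 2).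
  have gr : [set p + t *: v | t in [set: R]] (x + r *: v).
    by exists (t0 + r) => //; rewrite -xE scalerDl addrA.
  split => //; apply: (eK r); last exact: gA.
  rewrite /ball/= sub0r normrN ltr_norml /r; apply/andP; split; nra.
- exists 2^-1; first by apply/andP; split; lra.
  by rewrite segE mulfV ?pnatr_eq0// subrr mul0r scale0r addr0.
Qed.

(** Makes the symmetric set around [x] absorbing. The segment given by [rai] need not be centered at
    [x], but [x] divides it in the ratio [s : 1 - s], so moving by [r *: (a - b)] stays inside
    whenever [|r| < min(s, 1 - s)]. *)
Lemma rai_symmetric K x v : rai K x -> aff K (x + v) ->
  exists2 t : R, 0 < t & K (x + t *: v) /\ K (x - t *: v).
Proof.
move=> [Kx raiK] Av.
have [->|v0] := eqVneq v 0.
  by exists 1 => //; rewrite scaler0 subr0 addr0.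
have [_ _ LZ] := affine_direction (@affine_aff K) (subset_aff Kx).
have [] := raiK [set x + t *: v | t in [set: R]].
- by exists x, v.
- by move=> _ [t _ <-]; exact: LZ.
- by exists 0 => //; rewrite scale0r addr0.
move=> a [b [ab sub [s /andP[s0 s1] xE]]].
have xD (r : R) : x + r *: (a - b) = (1 - (s - r)) *: a + (s - r) *: b.
  rewrite -xE scalerBr addrACA -scalerDl -scalerBl.
  by congr (_ *: _ + _); lra.
(* Only the open segment is known to lie on the line, not [a] and [b]; a second inner point
   therefore serves to show that [a - b] is a multiple of [v]. *)
have [|[c _ cE] _] := sub (x + (s / 2) *: (a - b)).
  by exists (s - s / 2); [apply/andP; split; lra|rewrite xD].
have abE : a - b = (c / (s / 2)) *: v.
  have /addrI cv := cE; rewrite mulrC -scalerA cv scalerA mulVf ?scale1r//.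
  by rewrite gt_eqF ?divr_gt0.
set k := c / (s / 2) in abE.
have k0 : k != 0.
  by apply: contra_neq ab => k0; apply/eqP; rewrite -subr_eq0 abE k0 scale0r.
have Kr (r : R) : - Num.min s (1 - s) < r < Num.min s (1 - s) ->
    K (x + (r * k) *: v).
  rewrite ltrNl !lt_min => /andP[/andP[r1 r2] /andP[r3 r4]].
  have [|_] := sub (x + r *: (a - b)); last by rewrite abE scalerA.
  by exists (s - r); [apply/andP; split; lra|rewrite xD].
pose r := Num.min s (1 - s) / 2.
have min0 : 0 < Num.min s (1 - s) by rewrite lt_min s0 subr_gt0.
have Krk : K (x + (r * k) *: v).
  by apply: Kr; rewrite /r; apply/andP; split; lra.
have KNrk : K (x - (r * k) *: v).
  by rewrite -scaleNr -mulNr; apply: Kr; rewrite /r; apply/andP; split; lra.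
(* The factor [k] may be negative; then the two memberships trade places. *)
exists `|r * k|.
  by rewrite normr_gt0 mulf_neq0// gt_eqF// divr_gt0.
have [rk|rk] := ger0P (r * k); first by split.
by rewrite scaleNr opprK; split.
Qed.

Lemma rai_sub_ri m K : finest_locally_convex m -> convex_set K ->
  rai K `<=` ri m K.
Proof.
move=> mfin /convex_setP cK x raix; have [Kx _] := raix.
have Ax := subset_aff Kx.
apply/riP; split => //.
have Lsub := affine_direction (@affine_aff K) Ax.
set L := [set v | _] in Lsub; have [_ LD LZ] := Lsub.
have [M [[_ MD MZ] LM LMT]] := linear_subspace_complement Lsub.
pose C := [set u | K (x + u) /\ K (x - u)].
pose D := [set w | exists u v, [/\ C u, L u, M v & w = u + v]].
have HD : absolutely_convex_absorbing D.
  split.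
  - apply/convex_setP => _ _ t t01
      [u [v [[Ku KNu] Lu Mv ->]]] [u' [v' [[Ku' KNu'] Lu' Mv' ->]]].
    exists ((1 - t) *: u + t *: u'), ((1 - t) *: v + t *: v'); split.
    + split.
        have := cK _ _ t t01 Ku Ku'.
        by rewrite !scalerDr addrACA -scalerDl subrK scale1r.
      have := cK _ _ t t01 KNu KNu'.
      by rewrite !scalerDr addrACA -scalerDl subrK scale1r !scalerN -opprD.
    + by apply: LD; exact: LZ.
    + by apply: MD; exact: MZ.
    + by rewrite !scalerDr addrACA.
  - move=> _ [u [v [[Ku KNu] Lu Mv ->]]]; exists (- u), (- v); split.
    + by split => //; rewrite opprK.
    + by rewrite -scaleN1r; exact: LZ.
    + by rewrite -scaleN1r; exact: MZ.
    + by rewrite opprD.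
  (* A factor that brings the [L]-component into [C] works for [w], as [M] is stable under
     scaling. *)
  - move=> w; have [u [v [Lu Mv ->]]] := LMT w.
    have [t t0 Ct] := rai_symmetric raix Lu.
    exists t => //; exists (t *: u), (t *: v); split => //.
    + exact: LZ.
    + exact: MZ.
    + by rewrite scalerDr.
apply: filterS (finest_nbhs x mfin HD).
move=> _ [_ [u [v [[Ku _] Lu Mv ->]]] <-] Auv.
(* As [x + (u + v)] is in [aff K], [u + v] is in [L]; subtracting [u] puts [v] in both [L] and
   [M]. *)
suff -> : v = 0 by rewrite addr0.
apply: LM; split => //.
have := LD _ _ Auv (LZ (-1) _ Lu).
by rewrite scaleN1r addrAC subrr add0r.
Qed.

End RelativeInterior.

Theorem corollary3p3 (R : realType) (V : lmodType R) (m : Topological V)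
    (Hm : finest_locally_convex m) (K : set V) (HK : convex_set K) :
  ri m K = rai K.
Proof.
apply/seteqP; split; last exact: rai_sub_ri.
by apply: ri_sub_rai; case: Hm => -[].
Qed.
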